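(* For every $\varepsilon>0$ there exists an instance $\mathcal{I}$ of the Square Strip Packing Problem such that $$\frac{h_{\text{BL}}^{\text{best}}(\mathcal{I})}{h_{\text{OPT}}(\mathcal{I})}\ \ge\ \frac43-\varepsilon .$$ That is, the approximation ratio of the bottom-left algorithm for the Square Strip Packing Problem cannot be better than $4/3-\varepsilon$, even if the squares are ordered in the best possible way.
   Context: Strip Packing Problem (SPP): given a strip width $W>0$ and rectangles $r_1,\dots,r_n$ with widths $w_i\le W$ and heights $h_i$, a packing assigns to each $r_i$ a lower-left corner $(x_i,y_i)$; it is feasible if $x_i\ge 0$, $x_i+w_i\le W$, $y_i\ge 0$ for all $i$, and the open rectangles $(x_i,x_i+w_i)\times(y_i,y_i+h_i)$ are pairwise disjoint. Rotations are not allowed. The height of a packing is $\max_i (y_i+h_i)$, and $h_{\text{OPT}}(\mathcal{I})$ is the minimum height of a feasible packing. The Square Strip Packing Problem (SSPP) is the special case where all rectangles are squares. Bottom-left algorithm: given an ordering $r_1,\dots,r_n$, place $r_1$ at $(0,0)$. Then, for $i=2,\dots,n$, place $r_i$ at a position $(x_i,y_i)$ such that the first $i$ rectangles form a feasible packing and $(y_i,x_i)$ is lexicographically minimal among all such positions (lowest position, leftmost in case of ties). $h_{\text{BL}}^{\text{best}}(\mathcal{I})$ denotes the minimum, over all $n!$ orderings, of the height of the packing produced by the bottom-left algorithm. *)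

(* Defs.v *)
From Stdlib Require Import Reals Lra Lia List Permutation.
Import ListNotations.
Open Scope R_scope.

(* An SPP instance: strip width W, n rectangles indexed 0..n-1 with
   widths w i and heights h i.  A packing assigns lower-left corners
   (x i, y i).  *)

Definition open_rects_disjoint (x1 y1 w1 h1 x2 y2 w2 h2 : R) : Prop :=
  ~ (exists p q : R,
        x1 < p < x1 + w1 /\ y1 < q < y1 + h1 /\
        x2 < p < x2 + w2 /\ y2 < q < y2 + h2).

Definition feasible_packing (W : R) (n : nat) (w h x y : nat -> R) : Prop :=
  (forall i, (i < n)%nat -> 0 <= x i /\ x i + w i <= W /\ 0 <= y i) /\
  (forall i j, (i < n)%nat -> (j < n)%nat -> i <> j ->
     open_rects_disjoint (x i) (y i) (w i) (h i) (x j) (y j) (w j) (h j)).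

Definition packing_height (n : nat) (h y : nat -> R) : R :=
  fold_right Rmax 0 (map (fun i => y i + h i) (seq 0 n)).

Definition feasible_position (W : R) (w h x y : nat -> R)
    (placed : list nat) (r : nat) (a b : R) : Prop :=
  0 <= a /\ a + w r <= W /\ 0 <= b /\
  (forall j, In j placed ->
     open_rects_disjoint a b (w r) (h r) (x j) (y j) (w j) (h j)).

(* (x,y) is the packing produced by the bottom-left algorithm with ordering
   [ord] (a permutation of 0..n-1): the k-th rectangle of the ordering is
   placed at a feasible position (given the previously placed ones) whose
   (y, x) is lexicographically minimal.  For k = 0 this forces (0,0).
   Since the lexicographic minimum is unique, this relation determines the
   packing uniquely. *)
Definition BL_packing (W : R) (n : nat) (w h : nat -> R) (ord : list nat)
    (x y : nat -> R) : Prop :=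
  forall k, (k < n)%nat ->
    let r := nth k ord 0%nat in
    let placed := firstn k ord in
    feasible_position W w h x y placed r (x r) (y r) /\
    (forall a b, feasible_position W w h x y placed r a b ->
       y r < b \/ (y r = b /\ x r <= a)).

(* Main.v *)
(* For small [d > 0] take a strip of width [5 - 2d], two squares of side
   [2 - 2d], six of side [1] and one of side [1 + d].  They pack to height
   [3 + d]: one big square on the floor at the right, the other one on three unit
   squares at the left, the square of side [1 + d] between the big ones, and the
   last three unit squares in a row on top of it and of the right big square.
   The bottom-left rule spoils this top row: the middle square is slightly higher
   than the floor big square, so a unit square drops next to it instead of
   resting partly on it, and too little width remains for the other two.  As [d]
   tends to [0] the squares have total area [3 * 5], so every column is needed,
   and every order reaches at least [4 - 4d].

   The algorithm only compares affine functions of [d], so one finite exploration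
   of the 252 orders covers all [d] in [(0, 1/10]]; it is exhaustive because a
   bottom-left position has its left side on the strip border or on a right side,
   and its bottom on the floor or on a top side. *)
Require Import Defs.
From Stdlib Require Import Reals Lra Lia List Permutation ZArith Bool Classical.
Import ListNotations.
Open Scope R_scope.

(** * Bottom-left positions lie on a finite grid *)

(** If all four separations fail, then both projections overlap in nonempty open intervals, by
    positivity of the sides; the midpoints of these overlaps form a common interior point. *)
Lemma open_rects_disjoint_iff (x1 y1 w1 h1 x2 y2 w2 h2 : R) :
  0 < w1 -> 0 < h1 -> 0 < w2 -> 0 < h2 ->
  open_rects_disjoint x1 y1 w1 h1 x2 y2 w2 h2 <->
  x1 + w1 <= x2 \/ x2 + w2 <= x1 \/ y1 + h1 <= y2 \/ y2 + h2 <= y1.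
Proof.
  intros; unfold open_rects_disjoint; split.
  - intros Hd; apply NNPP; intros Hn; apply Hd.
    assert (Hp : Rmax x1 x2 < Rmin (x1 + w1) (x2 + w2)).
    { apply Rmax_lub_lt; apply Rmin_glb_lt; lra. }
    assert (Hq : Rmax y1 y2 < Rmin (y1 + h1) (y2 + h2)).
    { apply Rmax_lub_lt; apply Rmin_glb_lt; lra. }
    exists ((Rmax x1 x2 + Rmin (x1 + w1) (x2 + w2)) / 2).
    exists ((Rmax y1 y2 + Rmin (y1 + h1) (y2 + h2)) / 2).
    pose proof (Rmax_l x1 x2); pose proof (Rmax_r x1 x2).
    pose proof (Rmax_l y1 y2); pose proof (Rmax_r y1 y2).
    pose proof (Rmin_l (x1 + w1) (x2 + w2)); pose proof (Rmin_r (x1 + w1) (x2 + w2)).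
    pose proof (Rmin_l (y1 + h1) (y2 + h2)); pose proof (Rmin_r (y1 + h1) (y2 + h2)).
    lra.
  - intros Hs (p & q & Hpq); lra.
Qed.

(** Rounds one coordinate of a position down to the nearest edge or border, without passing any
    edge. *)
Lemma greatest_below (l : list R) (a : R) :
  0 <= a ->
  exists a', In a' (0 :: l) /\ 0 <= a' <= a /\ forall z, In z l -> z <= a -> z <= a'.
Proof.
  intros Ha; induction l as [|t l (a' & Hin & Ha' & Hmax)].
  - exists 0; simpl; split; [auto|]; split; [lra|easy].
  - assert (Hc : exists m, (m = t \/ m = a') /\ m <= a /\ a' <= m /\ (t <= a -> t <= m)).
    { destruct (Rle_dec t a), (Rle_dec a' t);
        (exists t; split; [tauto|lra]) || (exists a'; split; [tauto|lra]). }
    destruct Hc as (m & Hm & Hma & Ham & Htm).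
    exists m; split; [simpl in *; intuition (subst; auto)|]; split; [lra|].
    intros z [<-|Hz] Hza; [auto|]. specialize (Hmax z Hz Hza); lra.
Qed.

Definition grid (w h x y : nat -> R) (placed : list nat) : list (R * R) :=
  list_prod (0 :: map (fun j => x j + w j) placed)
            (0 :: map (fun j => y j + h j) placed).

(** Each coordinate is rounded down separately. Lying left of or below a placed rectangle survives
    any decrease; lying right of or above it survives because the rounding stops at its edge at the
    latest. *)
Lemma feasible_position_to_grid (W : R) (w h x y : nat -> R)
    (placed : list nat) (r : nat) (a b : R) :
  (forall j, In j (r :: placed) -> 0 < w j /\ 0 < h j) ->
  feasible_position W w h x y placed r a b ->
  exists a' b', In (a', b') (grid w h x y placed) /\ a' <= a /\ b' <= b /\
    feasible_position W w h x y placed r a' b'.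
Proof.
  intros Hpos (Ha & HaW & Hb & Hd).
  destruct (greatest_below (map (fun j => x j + w j) placed) a Ha)
    as (a' & Hina & Ha' & Hmaxa).
  destruct (greatest_below (map (fun j => y j + h j) placed) b Hb)
    as (b' & Hinb & Hb' & Hmaxb).
  exists a', b'; split; [now apply in_prod|].
  split; [lra|]; split; [lra|].
  split; [lra|]; split; [lra|]; split; [lra|].
  intros j Hj; specialize (Hd j Hj).
  pose proof (Hpos r (or_introl eq_refl)); pose proof (Hpos j (or_intror Hj)).
  apply open_rects_disjoint_iff in Hd; try tauto.
  apply open_rects_disjoint_iff; try tauto.
  pose proof (Hmaxa (x j + w j) (in_map (fun j => x j + w j) _ _ Hj)).
  pose proof (Hmaxb (y j + h j) (in_map (fun j => y j + h j) _ _ Hj)).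
  lra.
Qed.

Definition lex_le (c c' : R * R) : Prop :=
  snd c < snd c' \/ (snd c = snd c' /\ fst c <= fst c').

Lemma exists_lex_min (P : R * R -> Prop) (l : list (R * R)) :
  (exists c, In c l /\ P c) ->
  exists c, In c l /\ P c /\ forall c', In c' l -> P c' -> lex_le c c'.
Proof.
  induction l as [|t l IH]; intros (c & Hc & HP); [easy|].
  destruct (classic (exists c, In c l /\ P c)) as [Hex|Hnex].
  - destruct (IH Hex) as (m & Hm & HPm & Hmin).
    destruct (classic (P t /\ lex_le t m)) as [[HPt Htm]|Htm].
    + exists t; simpl; repeat split; auto.
      intros c' [<-|Hc'] HP'; [unfold lex_le; lra|].
      specialize (Hmin c' Hc' HP'); unfold lex_le in *; lra.
    + exists m; simpl; repeat split; auto.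
      intros c' [<-|Hc'] HP'; [|auto].
      apply NNPP; intros Hn; apply Htm; split; [easy|].
      unfold lex_le in *; lra.
  - destruct Hc as [->|Hc]; [|now destruct Hnex; exists c].
    exists c; simpl; repeat split; auto.
    intros c' [<-|Hc'] HP'; [unfold lex_le; lra|].
    now destruct Hnex; exists c'.
Qed.

(** * Existence of bottom-left positions and packings *)

Definition bl_position (W : R) (w h x y : nat -> R)
    (placed : list nat) (r : nat) (a b : R) : Prop :=
  feasible_position W w h x y placed r a b /\
  forall a' b', feasible_position W w h x y placed r a' b' ->
    b < b' \/ (b = b' /\ a <= a').

Lemma bl_position_in_grid (W : R) (w h x y : nat -> R)
    (placed : list nat) (r : nat) (a b : R) :
  (forall j, In j (r :: placed) -> 0 < w j /\ 0 < h j) ->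
  bl_position W w h x y placed r a b -> In (a, b) (grid w h x y placed).
Proof.
  intros Hpos (Hf & Hmin).
  destruct (feasible_position_to_grid _ _ _ _ _ _ _ _ _ Hpos Hf)
    as (a' & b' & Hin & Ha & Hb & Hf').
  specialize (Hmin _ _ Hf').
  replace a with a' by lra; replace b with b' by lra; easy.
Qed.

(** A height above all tops is feasible, so some grid point is. A lexicographic minimum over the
    finite grid is global, since every feasible position has a feasible grid point weakly below and
    to its left. *)
Lemma bl_position_exists (W : R) (w h x y : nat -> R) (placed : list nat) (r : nat) :
  (forall j, In j (r :: placed) -> 0 < w j /\ 0 < h j) -> w r <= W ->
  exists a b, bl_position W w h x y placed r a b.
Proof.
  intros Hpos HW.
  assert (Hub : exists b, 0 <= b /\ forall j, In j placed -> y j + h j <= b).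
  { clear; induction placed as [|t l (b & Hb & Hl)].
    - exists 0; split; [lra|easy].
    - exists (Rmax b (y t + h t)).
      pose proof (Rmax_l b (y t + h t)); pose proof (Rmax_r b (y t + h t)).
      split; [lra|]. intros j [<-|Hj]; [lra|]. specialize (Hl j Hj); lra. }
  destruct Hub as (b0 & Hb0 & Hub).
  assert (Hf0 : feasible_position W w h x y placed r 0 b0).
  { repeat split; try lra. intros j Hj.
    pose proof (Hpos r (or_introl eq_refl)); pose proof (Hpos j (or_intror Hj)).
    apply open_rects_disjoint_iff; try tauto. specialize (Hub j Hj); lra. }
  destruct (exists_lex_min
    (fun c => feasible_position W w h x y placed r (fst c) (snd c))
    (grid w h x y placed)) as ([a b] & Hin & Hf & Hmin).
  { destruct (feasible_position_to_grid _ _ _ _ _ _ _ _ _ Hpos Hf0)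
      as (a' & b' & H). exists (a', b'); simpl; tauto. }
  exists a, b; split; [easy|]. intros a1 b1 Hf1.
  destruct (feasible_position_to_grid _ _ _ _ _ _ _ _ _ Hpos Hf1)
    as (a' & b' & Hin' & Ha & Hb & Hf').
  specialize (Hmin (a', b') Hin' Hf'); unfold lex_le in Hmin; simpl in Hmin; lra.
Qed.

Lemma bl_position_ext (W : R) (w h x y x' y' : nat -> R)
    (placed : list nat) (r : nat) (a b : R) :
  (forall j, In j placed -> x j = x' j /\ y j = y' j) ->
  bl_position W w h x y placed r a b -> bl_position W w h x' y' placed r a b.
Proof.
  intros Heq (Hf & Hmin).
  assert (Hiff : forall a b, feasible_position W w h x y placed r a b <->
                             feasible_position W w h x' y' placed r a b).
  { intros; unfold feasible_position; split; intros (H1 & H2 & H3 & H4);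
      repeat split; auto; intros j Hj; destruct (Heq j Hj) as [Hx Hy];
      specialize (H4 j Hj); rewrite ?Hx, ?Hy in *; exact H4. }
  split; [now apply Hiff|]. intros a' b' Hf'; apply Hmin; now apply Hiff.
Qed.

Lemma nth_notin_firstn (l : list nat) (k : nat) :
  NoDup l -> (k < length l)%nat -> ~ In (nth k l 0%nat) (firstn k l).
Proof.
  intros Hnd Hk Hin.
  rewrite <- (firstn_skipn k l) in Hnd.
  destruct (skipn k l) as [|t l'] eqn:E.
  { apply (f_equal (@length nat)) in E; rewrite length_skipn in E; simpl in E; lia. }
  assert (Ht : nth k l 0%nat = t).
  { rewrite <- (firstn_skipn k l), E, app_nth2; rewrite length_firstn; [|lia].
    replace (k - Nat.min k (length l))%nat with 0%nat by lia; easy. }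
  rewrite Ht in Hin. apply NoDup_remove_2 in Hnd.
  apply Hnd, in_or_app; now left.
Qed.

(** Ensures that a bound on all bottom-left packings of an order is not vacuous. The packing is
    built by changing the coordinate functions at one new index per step. *)
Lemma BL_packing_exists (W : R) (n : nat) (w h : nat -> R) (ord : list nat) :
  NoDup ord -> (n <= length ord)%nat ->
  (forall i, In i ord -> 0 < w i <= W /\ 0 < h i) ->
  exists x y, BL_packing W n w h ord x y.
Proof.
  intros Hnd Hn Hpos; induction n as [|n IH].
  { exists (fun _ => 0), (fun _ => 0); intros k Hk; lia. }
  destruct IH as (x & y & Hxy); [lia|].
  set (r := nth n ord 0%nat).
  assert (Hr : In r ord) by (apply nth_In; lia).
  assert (Hsub : forall k j, In j (firstn k ord) -> In j ord).
  { intros k j Hj; rewrite <- (firstn_skipn k ord); apply in_or_app; auto. }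
  destruct (bl_position_exists W w h x y (firstn n ord) r) as (a & b & Hab).
  { intros j [<-|Hj]; [|apply Hsub in Hj]; split; apply Hpos; auto. }
  { apply Hpos; auto. }
  pose proof (nth_notin_firstn ord n Hnd ltac:(lia)) as Hnot; fold r in Hnot.
  exists (fun i => if Nat.eq_dec i r then a else x i),
         (fun i => if Nat.eq_dec i r then b else y i).
  intros k Hk; cbv zeta.
  (* Since [k <= n], these indices are among the first [n], which omit [r]; the update therefore
     leaves earlier placements intact. *)
  assert (Hext : forall j, In j (firstn k ord) ->
     x j = (if Nat.eq_dec j r then a else x j) /\
     y j = (if Nat.eq_dec j r then b else y j)).
  { intros j Hj; destruct (Nat.eq_dec j r) as [->|]; [|auto].
    destruct Hnot. replace k with (Nat.min k n) in Hj by lia.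
    rewrite <- firstn_firstn in Hj. rewrite <- (firstn_skipn k (firstn n ord)).
    apply in_or_app; auto. }
  destruct (Nat.eq_dec k n) as [->|Hkn].
  - fold r; destruct (Nat.eq_dec r r) as [_|]; [|easy].
    exact (bl_position_ext _ _ _ _ _ _ _ _ _ _ _ Hext Hab).
  - assert (Hkr : nth k ord 0%nat <> r).
    { intros E. apply (NoDup_nth ord 0%nat) in E; auto; lia. }
    destruct (Nat.eq_dec (nth k ord 0%nat) r) as [|_]; [easy|].
    refine (bl_position_ext _ _ _ _ _ _ _ _ _ _ _ Hext _).
    apply (Hxy k); lia.
Qed.

(** * Checking all orders at once for every small [d] *)

(* An affine function of [d], given by its value at [0] and by ten times its
   value at [1/10]: comparing both entries compares it on all of [(0, 1/10]].
   A comparison that returns [false] carries no information. *)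
Definition num : Type := (Z * Z)%type.

Definition affine (a b : Z) : num := (a, 10 * a + b)%Z.

(** Linear interpolation between the ends of the range; both weights are nonnegative on
    [(0, 1/10]]. *)
Definition val (d : R) (p : num) : R := (1 - 10 * d) * IZR (fst p) + d * IZR (snd p).

Definition nadd (p q : num) : num := (fst p + fst q, snd p + snd q)%Z.

Definition nle (p q : num) : bool :=
  if (fst p <=? fst q)%Z then (snd p <=? snd q)%Z else false.

(** Strictness is asked of the second entry: its weight [d] is positive, whereas [1 - 10 * d]
    vanishes at [d = 1/10]. *)
Definition nlt (p q : num) : bool :=
  if (fst p <=? fst q)%Z then (snd p <? snd q)%Z else false.

Lemma val_affine (d : R) (a b : Z) : val d (affine a b) = IZR a + IZR b * d.
Proof. unfold val, affine; cbn [fst snd]; rewrite plus_IZR, mult_IZR; ring. Qed.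

Lemma val_nadd (d : R) (p q : num) : val d (nadd p q) = val d p + val d q.
Proof. unfold val, nadd; simpl; rewrite !plus_IZR; ring. Qed.

Lemma nle_sound (d : R) (p q : num) :
  0 < d <= 1 / 10 -> nle p q = true -> val d p <= val d q.
Proof.
  unfold nle, val; intros Hd H.
  destruct (Z.leb_spec (fst p) (fst q)) as [H1|]; [|easy].
  apply Z.leb_le, IZR_le in H; apply IZR_le in H1; nra.
Qed.

Lemma nlt_sound (d : R) (p q : num) :
  0 < d <= 1 / 10 -> nlt p q = true -> val d p < val d q.
Proof.
  unfold nlt, val; intros Hd H.
  destruct (Z.leb_spec (fst p) (fst q)) as [H1|]; [|easy].
  apply Z.ltb_lt, IZR_lt in H; apply IZR_le in H1; nra.
Qed.

(** * Symbolic squares and the exploration of orders *)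

Record square := Square { sx : num; sy : num; side : num }.

Definition right_edge (t : square) : num := nadd (sx t) (side t).
Definition top_edge (t : square) : num := nadd (sy t) (side t).

Definition separated (q t : square) : bool :=
  if nle (right_edge q) (sx t) then true
  else if nle (right_edge t) (sx q) then true
  else if nle (top_edge q) (sy t) then true
  else nle (top_edge t) (sy q).

Definition overlapping (q t : square) : bool :=
  if nlt (sx t) (right_edge q) then
    if nlt (sx q) (right_edge t) then
      if nlt (sy t) (top_edge q) then nlt (sy q) (top_edge t) else false
    else false
  else false.

Definition admissible (W : num) (sqs : list square) (q : square) : bool :=
  if nle (affine 0 0) (sx q) && nle (right_edge q) W && nle (affine 0 0) (sy q)
  then forallb (separated q) sqs else false.

(** Not the negation of [admissible]: each test is one-sided, and both may fail when the answer
    depends on [d]. A candidate that neither test nor comparison excludes is explored. *)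
Definition inadmissible (W : num) (sqs : list square) (q : square) : bool :=
  if nlt W (right_edge q) then true else existsb (overlapping q) sqs.

Definition lower_left (q t : square) : bool :=
  if nlt (sy q) (sy t) then true
  else if nle (sy q) (sy t) then nlt (sx q) (sx t) else false.

Definition num_eq_dec (p q : num) : {p = q} + {p <> q}.
Proof. decide equality; apply Z.eq_dec. Defined.

Definition candidates (sqs : list square) (s : num) : list square :=
  map (fun c => Square (fst c) (snd c) s)
    (list_prod (nodup num_eq_dec (affine 0 0 :: map right_edge sqs))
               (nodup num_eq_dec (affine 0 0 :: map top_edge sqs))).

(* Only a guess: [always_reaches] checks again that its result is admissible. *)
Definition guess_position (W : num) (sqs cs : list square) : option square :=
  fold_left (fun best q =>
    if match best with Some t => lower_left t q | None => false end then best
    else if admissible W sqs q then Some q else best) cs None.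

Fixpoint remove_one (p : num) (l : list num) : list num :=
  match l with
  | [] => []
  | q :: l' => if num_eq_dec p q then l' else q :: remove_one p l'
  end.

(* Squares of equal side are interchangeable, so branching over the distinct
   remaining sides covers all orders. *)
Fixpoint always_reaches (W lim : num) (fuel : nat) (sqs : list square)
    (rem : list num) : bool :=
  if existsb (fun t => nle lim (top_edge t)) sqs then true else
  match fuel with
  | O => false
  | S fuel' =>
      forallb (fun s =>
        let cs := candidates sqs s in
        match guess_position W sqs cs with
        | None => false
        | Some best =>
            let t := Square (sx best) (sy best) s in
            if admissible W sqs t then
              forallb (fun q =>
                if lower_left t q then true
                else if inadmissible W sqs q then true
                else always_reaches W lim fuel' (sqs ++ [q]) (remove_one s rem)) cs
            else false
        end)
        (nodup num_eq_dec rem)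
  end.

(** * Soundness of the exploration *)

Lemma remove_one_permutation (p : num) (l rem : list num) :
  Permutation (p :: l) rem -> Permutation l (remove_one p rem).
Proof.
  intros H.
  assert (Hrem : forall m, In p m -> Permutation m (p :: remove_one p m)).
  { induction m as [|q m IH]; simpl; [easy|]. intros Hin.
    destruct (num_eq_dec p q) as [->|Hpq]; [easy|].
    destruct Hin as [->|Hin]; [easy|].
    rewrite (IH Hin) at 1; apply perm_swap. }
  apply (Permutation_cons_inv (a := p)).
  rewrite H; apply Hrem; apply (Permutation_in _ H); now left.
Qed.

Section Soundness.

Variables (d : R) (W lim : num) (s x y : nat -> R).
Hypothesis d_range : 0 < d <= 1 / 10.

(** Links an actual square to its symbolic description at the given [d]; positivity is included
    because the disjointness criterion asks for it. *)
Definition located (i : nat) (q : square) : Prop :=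
  x i = val d (sx q) /\ y i = val d (sy q) /\ s i = val d (side q) /\ 0 < s i.

Lemma separated_sound (q t : square) :
  0 < val d (side q) -> 0 < val d (side t) -> separated q t = true ->
  open_rects_disjoint
    (val d (sx q)) (val d (sy q)) (val d (side q)) (val d (side q))
    (val d (sx t)) (val d (sy t)) (val d (side t)) (val d (side t)).
Proof.
  intros Hq Ht H; apply open_rects_disjoint_iff; auto.
  rewrite <- !val_nadd; unfold separated, right_edge, top_edge in H.
  destruct nle eqn:E1 in H; [apply nle_sound with (d := d) in E1; auto|].
  destruct nle eqn:E2 in H; [apply nle_sound with (d := d) in E2; auto|].
  destruct nle eqn:E3 in H; [apply nle_sound with (d := d) in E3; auto|].
  apply nle_sound with (d := d) in H; auto.
Qed.

Lemma overlapping_sound (q t : square) :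
  0 < val d (side q) -> 0 < val d (side t) -> overlapping q t = true ->
  ~ open_rects_disjoint
    (val d (sx q)) (val d (sy q)) (val d (side q)) (val d (side q))
    (val d (sx t)) (val d (sy t)) (val d (side t)) (val d (side t)).
Proof.
  intros Hq Ht H Hd; apply open_rects_disjoint_iff in Hd; auto.
  rewrite <- !val_nadd in Hd; unfold overlapping, right_edge, top_edge in H.
  destruct nlt eqn:E1 in H; [|easy]; apply nlt_sound with (d := d) in E1; auto.
  destruct nlt eqn:E2 in H; [|easy]; apply nlt_sound with (d := d) in E2; auto.
  destruct nlt eqn:E3 in H; [|easy]; apply nlt_sound with (d := d) in E3; auto.
  apply nlt_sound with (d := d) in H; auto; lra.
Qed.

Variables (placed : list nat) (sqs : list square) (r : nat).
Hypothesis placed_located : Forall2 located placed sqs.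

Lemma located_of_In (j : nat) : In j placed -> exists t, In t sqs /\ located j t.
Proof.
  induction placed_located as [|i t l ts Hit Hl IH]; [easy|].
  intros [<-|Hj]; [exists t; simpl; auto|].
  destruct (IH Hl Hj) as (u & Hu & Hju); exists u; simpl; auto.
Qed.

Lemma In_of_located (t : square) : In t sqs -> exists j, In j placed /\ located j t.
Proof.
  induction placed_located as [|i u l us Hiu Hl IH]; [easy|].
  intros [<-|Ht]; [exists i; simpl; auto|].
  destruct (IH Hl Ht) as (j & Hj & Hjt); exists j; simpl; auto.
Qed.

Lemma admissible_sound (q : square) :
  s r = val d (side q) -> 0 < s r -> admissible W sqs q = true ->
  feasible_position (val d W) s s x y placed r (val d (sx q)) (val d (sy q)).
Proof.
  unfold admissible; intros Hr Hpos H.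
  destruct (nle _ _ && _ && _) eqn:E; [|easy].
  apply andb_prop in E as [E E3]; apply andb_prop in E as [E1 E2].
  apply nle_sound with (d := d) in E1, E2, E3; auto.
  unfold right_edge in E2; rewrite val_nadd in E2; rewrite val_affine in E1, E3.
  rewrite forallb_forall in H.
  split; [lra|]; split; [lra|]; split; [lra|].
  intros j Hj; destruct (located_of_In j Hj) as (t & Ht & Hx & Hy & Hs & Hsj).
  rewrite Hx, Hy, Hs, Hr; rewrite Hs in Hsj; rewrite Hr in Hpos.
  apply separated_sound; auto.
Qed.

Lemma inadmissible_sound (q : square) :
  s r = val d (side q) -> 0 < s r -> inadmissible W sqs q = true ->
  ~ feasible_position (val d W) s s x y placed r (val d (sx q)) (val d (sy q)).
Proof.
  unfold inadmissible; intros Hr Hpos H (_ & HW & _ & Hd).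
  destruct nlt eqn:E in H.
  - apply nlt_sound with (d := d) in E; auto.
    unfold right_edge in E; rewrite val_nadd in E; lra.
  - apply existsb_exists in H as (t & Ht & H).
    destruct (In_of_located t Ht) as (j & Hj & Hx & Hy & Hs & Hsj).
    specialize (Hd j Hj); rewrite Hx, Hy, Hs, Hr in Hd.
    rewrite Hs in Hsj; rewrite Hr in Hpos.
    now apply overlapping_sound in Hd.
Qed.

Lemma bl_position_in_candidates (p : num) :
  s r = val d p -> 0 < s r ->
  bl_position (val d W) s s x y placed r (x r) (y r) ->
  exists q, In q (candidates sqs p) /\ located r q /\ side q = p.
Proof.
  intros Hr Hpos Hbl.
  apply bl_position_in_grid in Hbl.
  2:{ intros j [<-|Hj]; [auto|].
      destruct (located_of_In j Hj) as (t & _ & _ & _ & _ & H); auto. }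
  apply in_prod_iff in Hbl as [Hx Hy].
  (* Stated for an arbitrary edge function, to serve right edges and top edges alike. *)
  assert (Hnum : forall (f : nat -> R) (g : square -> num),
    (forall j t, located j t -> f j = val d (g t)) ->
    forall a, In a (0 :: map f placed) ->
    exists u, In u (nodup num_eq_dec (affine 0 0 :: map g sqs)) /\ a = val d u).
  { intros f g Hfg a [<-|Ha].
    - exists (affine 0 0); rewrite nodup_In; split; [now left|].
      rewrite val_affine; ring.
    - apply in_map_iff in Ha as (j & <- & Hj).
      destruct (located_of_In j Hj) as (t & Ht & Hjt).
      exists (g t); rewrite nodup_In; split; [right; now apply in_map|auto]. }
  destruct (Hnum (fun j => x j + s j) right_edge) with (a := x r) as (u & Hu & Hxu); auto.
  { intros j t (H1 & _ & H2 & _); unfold right_edge; rewrite val_nadd; congruence. }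
  destruct (Hnum (fun j => y j + s j) top_edge) with (a := y r) as (v & Hv & Hyv); auto.
  { intros j t (_ & H1 & H2 & _); unfold top_edge; rewrite val_nadd; congruence. }
  exists (Square u v p); split; [|unfold located; simpl; auto].
  apply in_map_iff; exists (u, v); split; [easy|]; now apply in_prod.
Qed.

End Soundness.

(** The run of the algorithm follows one branch of the exploration: its next position is always a
    candidate, and the pruning never discards it. *)
Lemma always_reaches_sound (d : R) (W lim : num) (s x y : nat -> R)
    (sz : nat -> num) (ord : list nat) (sides : list num) :
  0 < d <= 1 / 10 ->
  (forall i, In i ord -> s i = val d (sz i) /\ 0 < s i) ->
  BL_packing (val d W) (length ord) s s ord x y ->
  Permutation (map sz ord) sides ->
  always_reaches W lim (length ord) [] sides = true ->
  exists i, In i ord /\ val d lim <= y i + s i.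
Proof.
  intros Hd Hs Hbl Hsides.
  (* Invariant: [sqs] describes the squares placed so far and [rem] is the multiset of sides still
     to come. *)
  assert (Hgen : forall l placed sqs rem, ord = placed ++ l ->
    Permutation (map sz l) rem -> Forall2 (located d s x y) placed sqs ->
    always_reaches W lim (length l) sqs rem = true ->
    exists i, In i ord /\ val d lim <= y i + s i).
  2:{ intros H; now apply (Hgen ord [] [] sides). }
  induction l as [|r l IH]; intros placed sqs rem Hord Hperm Hloc H; simpl in H.
  all: destruct existsb eqn:E in H; [clear H|].
  1,3: apply existsb_exists in E as (t & Ht & E);
    destruct (In_of_located _ _ _ _ _ _ Hloc t Ht) as (j & Hj & _ & Hy & Hsj & _);
    exists j; split; [rewrite Hord; apply in_or_app; auto|];
    apply nle_sound with (d := d) in E; auto;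
    unfold top_edge in E; rewrite val_nadd in E; lra.
  - easy.
  - clear E; rewrite forallb_forall in H.
    assert (Hr : In r ord) by (rewrite Hord; apply in_or_app; simpl; auto).
    destruct (Hs r Hr) as [Hsr Hpos].
    specialize (H (sz r)); rewrite nodup_In in H.
    specialize (H (Permutation_in _ Hperm (or_introl eq_refl))).
    destruct guess_position as [best|]; [|easy].
    set (t := Square (sx best) (sy best) (sz r)) in H.
    destruct admissible eqn:Ht in H; [|easy].
    assert (Hblr : bl_position (val d W) s s x y placed r (x r) (y r)).
    { specialize (Hbl (length placed)); cbv zeta in Hbl.
      rewrite Hord in Hbl; rewrite length_app in Hbl; simpl in Hbl.
      rewrite nth_middle, firstn_app, Nat.sub_diag, firstn_all, app_nil_r in Hbl.
      apply Hbl; lia. }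
    destruct (bl_position_in_candidates d W s x y placed sqs r Hloc (sz r))
      as (q & Hq & Hrq & Hside); auto.
    destruct Hblr as [Hf Hmin].
    destruct Hrq as (Hx & Hy & Hsq & _).
    apply admissible_sound with (s := s) (x := x) (y := y) (placed := placed)
      (r := r) (d := d) in Ht; auto.
    specialize (Hmin _ _ Ht).
    rewrite forallb_forall in H; specialize (H q Hq).
    destruct lower_left eqn:Hlow in H.
    (* [t] is feasible, so the bottom-left position cannot come strictly after it. *)
    { exfalso; unfold lower_left in Hlow.
      destruct nlt eqn:E1 in Hlow; [apply nlt_sound with (d := d) in E1; auto; lra|].
      destruct nle eqn:E2 in Hlow; [|easy].
      apply nle_sound with (d := d) in E2; auto.
      apply nlt_sound with (d := d) in Hlow; auto; lra. }
    destruct inadmissible eqn:Hin in H.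
    { exfalso; apply inadmissible_sound with (s := s) (x := x) (y := y)
        (placed := placed) (r := r) (d := d) in Hin; auto.
      apply Hin; now rewrite <- Hx, <- Hy. }
    apply (IH (placed ++ [r]) (sqs ++ [q]) (remove_one (sz r) rem)); auto.
    + rewrite <- app_assoc; easy.
    + now apply remove_one_permutation.
    + apply Forall2_app; [easy|]; constructor; [|constructor].
      unfold located; auto.
Qed.

(** * Bounds on the height of a packing *)

Lemma packing_height_ge (n : nat) (h y : nat -> R) (i : nat) :
  (i < n)%nat -> y i + h i <= packing_height n h y.
Proof.
  intros Hi; unfold packing_height.
  assert (Hin : In i (seq 0 n)) by (apply in_seq; lia).
  induction (seq 0 n) as [|j l IH]; simpl; [easy|].
  destruct Hin as [->|Hin]; [apply Rmax_l|].
  apply Rle_trans with (2 := Rmax_r _ _); auto.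
Qed.

Lemma packing_height_le (n : nat) (h y : nat -> R) (c : R) :
  0 <= c -> (forall i, (i < n)%nat -> y i + h i <= c) -> packing_height n h y <= c.
Proof.
  intros Hc H; unfold packing_height.
  assert (Hl : forall i, In i (seq 0 n) -> y i + h i <= c).
  { intros i Hi; apply H; apply in_seq in Hi; lia. }
  induction (seq 0 n) as [|j l IH]; simpl in *; [easy|].
  apply Rmax_lub; auto.
Qed.

(** * The instance *)

Definition strip : num := affine 5 (-2).

(** In order: the big squares at the right and at the left, the unit row on the floor, the top row
    at height [2 + d], and the square of side [1 + d]. *)
Definition optimum : list square :=
  ([Square (affine 3 0) (affine 0 0) (affine 2 (-2));
    Square (affine 0 0) (affine 1 0) (affine 2 (-2));
    Square (affine 0 0) (affine 0 0) (affine 1 0);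
    Square (affine 1 0) (affine 0 0) (affine 1 0);
    Square (affine 2 0) (affine 0 0) (affine 1 0);
    Square (affine 2 (-2)) (affine 2 1) (affine 1 0);
    Square (affine 3 (-2)) (affine 2 1) (affine 1 0);
    Square (affine 4 (-2)) (affine 2 1) (affine 1 0);
    Square (affine 2 (-2)) (affine 1 0) (affine 1 1)])%Z.

Definition opt (i : nat) : square :=
  nth i optimum (Square (affine 0 0) (affine 0 0) (affine 0 0)).

Lemma opt_In (i : nat) : (i < 9)%nat -> In (opt i) optimum.
Proof. intros Hi; apply nth_In; easy. Qed.

Lemma opt_facts (d : R) (i : nat) :
  0 < d <= 1 / 10 -> (i < 9)%nat ->
  0 < val d (side (opt i)) /\ 0 <= val d (sx (opt i)) /\ 0 <= val d (sy (opt i)) /\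
  val d (sx (opt i)) + val d (side (opt i)) <= val d strip /\
  val d (sy (opt i)) + val d (side (opt i)) <= val d (affine 3 1).
Proof.
  intros Hd Hi.
  (* Against an empty list of squares, [admissible] tests only the borders of the strip. *)
  assert (H : forallb (fun q => nlt (affine 0 0) (side q) && admissible strip [] q &&
                         nle (top_edge q) (affine 3 1)) optimum = true) by easy.
  rewrite forallb_forall in H; specialize (H _ (opt_In i Hi)).
  unfold admissible in H; rewrite !andb_true_iff in H.
  destruct H as [[H1 H2] H5].
  destruct (nle _ _ && _ && _) eqn:E in H2; [clear H2|easy].
  rewrite !andb_true_iff in E; destruct E as [[H2 H3] H4].
  apply nlt_sound with (d := d) in H1; auto.
  apply nle_sound with (d := d) in H2, H3, H4, H5; auto.
  unfold right_edge in H3; unfold top_edge in H5.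
  rewrite val_nadd in H3, H5; rewrite val_affine in H1, H2, H4; lra.
Qed.

Lemma opt_feasible (d : R) :
  0 < d <= 1 / 10 ->
  feasible_packing (val d strip) 9 (fun i => val d (side (opt i)))
    (fun i => val d (side (opt i))) (fun i => val d (sx (opt i)))
    (fun i => val d (sy (opt i))).
Proof.
  intros Hd; split.
  - intros i Hi; pose proof (opt_facts d i Hd Hi); tauto.
  - intros i j Hi Hj Hij.
    assert (H : forallb (fun i => forallb (fun j => (i =? j)%nat ||
                  separated (opt i) (opt j)) (seq 0 9)) (seq 0 9) = true) by easy.
    rewrite forallb_forall in H; specialize (H i); rewrite in_seq in H.
    specialize (H ltac:(lia)); rewrite forallb_forall in H; specialize (H j).
    rewrite in_seq in H; specialize (H ltac:(lia)).
    apply Nat.eqb_neq in Hij; rewrite Hij in H.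
    pose proof (opt_facts d i Hd Hi); pose proof (opt_facts d j Hd Hj).
    apply separated_sound; tauto.
Qed.

Theorem theorem1 :
  forall eps : R, 0 < eps ->
  exists (W : R) (n : nat) (s : nat -> R),
    0 < W /\ (0 < n)%nat /\
    (forall i, (i < n)%nat -> 0 < s i <= W) /\
    exists xo yo : nat -> R,
      feasible_packing W n s s xo yo /\
      forall ord : list nat, Permutation ord (seq 0 n) ->
        (exists x y, BL_packing W n s s ord x y) /\
        (forall x y, BL_packing W n s s ord x y ->
           packing_height n s y >= (4/3 - eps) * packing_height n s yo).
Proof.
  intros eps Heps.
  (* The ratio [(4 - 4d) / (3 + d)] is at least [4/3 - 16d/9], so [d <= eps / 2] suffices; [1/10] is
     the range of the symbolic comparisons. *)
  set (d := Rmin (1 / 10) (eps / 2)).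
  assert (Hd : 0 < d <= 1 / 10 /\ d <= eps / 2).
  { unfold d; pose proof (Rmin_l (1 / 10) (eps / 2)).
    pose proof (Rmin_r (1 / 10) (eps / 2)).
    assert (0 < Rmin (1 / 10) (eps / 2)) by (apply Rmin_glb_lt; lra); lra. }
  destruct Hd as [Hd Hdeps]; clearbody d.
  exists (val d strip), 9%nat, (fun i => val d (side (opt i))).
  assert (HW : val d strip = 5 - 2 * d) by (unfold strip; rewrite val_affine; ring).
  assert (Hsize : forall i, (i < 9)%nat -> 0 < val d (side (opt i)) <= val d strip).
  { intros i Hi; pose proof (opt_facts d i Hd Hi); lra. }
  split; [lra|]; split; [lia|]; split; [easy|].
  (* Any feasible packing bounds the optimal height from above, so a ratio against this one also
     holds against the optimum. *)
  exists (fun i => val d (sx (opt i))), (fun i => val d (sy (opt i))).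
  split; [now apply opt_feasible|].
  intros ord Hord.
  assert (Hlt : forall i, In i ord -> (i < 9)%nat).
  { intros i Hi; apply (Permutation_in _ Hord) in Hi; apply in_seq in Hi; lia. }
  assert (Hlen : length ord = 9%nat) by now rewrite (Permutation_length Hord).
  split.
  - apply BL_packing_exists; [|lia|].
    + apply (Permutation_NoDup (Permutation_sym Hord)), seq_NoDup.
    + intros i Hi; pose proof (Hsize i (Hlt i Hi)); lra.
  - intros x y Hbl.
    (* The limit [4 - 4d] is the height of two big squares stacked on each other. *)
    destruct (always_reaches_sound d strip (affine 4 (-4)) (fun i => val d (side (opt i)))
      x y (fun i => side (opt i)) ord (map (fun i => side (opt i)) (seq 0 9)))
      as (i & Hi & Htop); auto.
    + intros i Hi; split; [easy|]; apply Hsize; auto.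
    + now rewrite Hlen.
    + now apply Permutation_map.
    + rewrite Hlen; vm_compute; easy.
    + pose proof (packing_height_ge 9 (fun i => val d (side (opt i))) y i (Hlt i Hi)).
      pose proof (packing_height_ge 9 (fun i => val d (side (opt i)))
        (fun i => val d (sy (opt i))) 0 ltac:(lia)).
      pose proof (opt_facts d 0 Hd ltac:(lia)) as Hfst.
      assert (Hopt : packing_height 9 (fun i => val d (side (opt i)))
        (fun i => val d (sy (opt i))) <= 3 + d).
      { apply packing_height_le; [lra|]; intros j Hj; pose proof (opt_facts d j Hd Hj) as Hj'.
        rewrite (val_affine d 3 1) in Hj'; lra. }
      rewrite val_affine in Htop; simpl in *.
      set (hbl := packing_height 9 _ y) in *.
      set (hopt := packing_height 9 _ _) in *.
      (* If [eps >= 4/3], the factor is nonpositive and [hopt > 0], known from square 0, suffices;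
         otherwise [hopt <= 3 + d] is multiplied by a positive factor. *)
      destruct (Rle_dec (4 / 3) eps); nra.
Qed.
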